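(* Let $A$ be an $n\times n$ real symmetric matrix with orthogonal eigendecomposition $A=W\Lambda W^*$ ($W$ orthogonal, $\Lambda$ real diagonal), let $\mathbf{b}$ be an $n\times 1$ vector, and let $G(x)=Ax+\mathbf{b}$. Suppose that the eigenvalues of $A$ are contained in an interval $[a,b]$, $a<b$, that contains neither $0$ nor $1$. Let $x^*$ be the fixed point of $G$, let $1\le m\le n$ and $k\ge m$ be integers, let $x_0$ be an initial vector, and suppose that $x_{j+1}=Ax_j+\mathbf{b}$ for $0\le j\le k-1$ and that $x_{k+1}$ is produced from $x_0,\dots,x_k$ by one step of Anderson acceleration based on the discrete $\ell^2$ norm with memory parameter $m$. Write $e_j=x_j-x^*$, $D_\mu=\Lambda(\Lambda-I)^{-1}$, $H=(\Lambda-I)^2\Lambda^{k-m}$, and $K_H=K_m(\Lambda,HW^*e_0)$, and assume that $K_H$ has linearly independent columns. Then $$\|D_\mu^{-1}W^*e_{k+1}\|_2\le C(a,b,m)\,\|D_\mu^{-1}W^*Ae_k\|_2,\qquad C(a,b,m)=\left|T_m\!\left(\frac{2ab-a-b}{b-a}\right)\right|^{-1},$$ where $T_m$ is the Chebyshev polynomial (of the first kind) of degree $m$.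
   Context: Krylov matrix: for an $n\times n$ matrix $M$ and an $n\times 1$ vector $v$, $K_m(M,v)=\begin{bmatrix}v & Mv & \cdots & M^{m-1}v\end{bmatrix}\in\mathbb{C}^{n\times m}$. One step of Anderson acceleration (AA) with memory parameter $m$ in the discrete $\ell^2$ norm: given $x_0,\dots,x_k$ with $k\ge m$, set $f_i=G(x_i)-x_i$, $\Delta f_i=f_{i+1}-f_i$, and $D_k=[\Delta f_{k-m},\dots,\Delta f_{k-1}]\in\mathbb{C}^{n\times m}$. Let $\gamma=(\gamma_0,\dots,\gamma_{m-1})^T$ be the minimizer of $\|f_k-D_kv\|_2$ over $v\in\mathbb{C}^m$, and set $$x_{k+1}=G(x_k)-\sum_{i=0}^{m-1}\gamma_i\left[G(x_{k-m+i+1})-G(x_{k-m+i})\right].$$ Equivalently, when $D_k$ has linearly independent columns and $X_k=[\Delta x_{k-m},\dots,\Delta x_{k-1}]$ with $\Delta x_i=x_{i+1}-x_i$, one has $x_{k+1}=x_k+(I-S_k)f_k$ with $S_k=(D_k+X_k)(D_k^*D_k)^{-1}D_k^*$. *)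

(* Defs.v *)
From mathcomp Require Import all_boot all_order all_algebra.
From mathcomp Require Import complex reals.

Set Implicit Arguments.
Unset Strict Implicit.
Unset Printing Implicit Defensive.

Import Order.TTheory GRing.Theory Num.Theory.
Import ComplexField.

Local Open Scope ring_scope.
Local Open Scope complex_scope.

Definition l2norm (R : realType) n (v : 'cV[R[i]]_n) : R :=
  Num.sqrt (\sum_(i < n) Normc.normc (v i 0) ^+ 2).

Definition complexmx (R : realType) m n (M : 'M[R]_(m, n)) : 'M[R[i]]_(m, n) :=
  map_mx (real_complex R) M.

Definition krylov (F : fieldType) n (m : nat) (M : 'M[F]_n) (v : 'cV[F]_n) :
    'M[F]_(n, m) :=
  \matrix_(i < n, j < m) (M ^+ j *m v) i 0.

Fixpoint chebyshevT (R : comNzRingType) (n : nat) : {poly R} :=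
  match n with
  | 0 => 1
  | n1.+1 =>
      match n1 with
      | 0 => 'X
      | n2.+1 => 2%:R *: ('X * chebyshevT R n1) - chebyshevT R n2
      end
  end.

Definition residual (R : realType) n (G : 'cV[R[i]]_n -> 'cV[R[i]]_n)
    (x : nat -> 'cV[R[i]]_n) (j : nat) : 'cV[R[i]]_n :=
  G (x j) - x j.

(* Used only for m <= k, so the subtraction k - m is not truncated. *)
Definition residual_diffs (R : realType) n (G : 'cV[R[i]]_n -> 'cV[R[i]]_n)
    (x : nat -> 'cV[R[i]]_n) (m k : nat) : 'M[R[i]]_(n, m) :=
  \matrix_(i < n, j < m)
    (residual G x (k - m + j).+1 - residual G x (k - m + j)%N) i 0.

Definition is_least_squares_solution (R : realType) n m (f : 'cV[R[i]]_n)
    (D : 'M[R[i]]_(n, m)) (gamma : 'cV[R[i]]_m) : Prop :=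
  forall v : 'cV[R[i]]_m, l2norm (f - D *m gamma) <= l2norm (f - D *m v).

(* x k.+1 comes from x 0, ..., x k by one step of Anderson acceleration with
   memory m.  It is a relation because the minimizer gamma is unique only when
   the columns of residual_diffs G x m k are linearly independent. *)
Definition anderson_step (R : realType) n (G : 'cV[R[i]]_n -> 'cV[R[i]]_n)
    (x : nat -> 'cV[R[i]]_n) (m k : nat) : Prop :=
  exists2 gamma : 'cV[R[i]]_m,
    is_least_squares_solution (residual G x k) (residual_diffs G x m k) gamma &
    x k.+1 = G (x k) -
      \sum_(i < m) gamma i 0 *:
        (G (x (k - m + i).+1) - G (x (k - m + i)%N)).

(* Main.v *)
(* In the eigenbasis, e_{k+1} is D_mu applied to the least-squares residual, so
   its D_mu^-1-norm is at most that of (Lam - 1) p(Lam) Lam^(k-m) W^* e_0 for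
   every polynomial p of degree at most m with p(1) = 1: these are exactly
   the 'X^m - ('X - 1) q with deg q < m.  Writing p(l) = l^m r(1/l), it remains
   to make r small on [1/b, 1/a] with r(1) = 1; the Chebyshev polynomial shifted to
   that interval does it, and (2ab - a - b)/(b - a) is the image of 1. *)
Require Import Defs.
From mathcomp Require Import all_boot all_order all_algebra.
From mathcomp Require Import complex reals.
From mathcomp Require Import ring lra.

Set Implicit Arguments.
Unset Strict Implicit.
Unset Printing Implicit Defensive.

Import Order.TTheory GRing.Theory Num.Theory.

Local Open Scope ring_scope.
Local Open Scope complex_scope.

(** With [D = L (L - 1)^-1], [L u = D (L - 1) u], so the inverse of [D] cancels. This turns both
    weighted norms of the theorem into norms of vectors [(Lam - 1) u], the form of a residual. *)
Lemma invmx_diag_quotient (F : fieldType) n p (L : 'M[F]_n) (u : 'M[F]_(n, p)) :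
  L \in unitmx -> L - 1%:M \in unitmx ->
  invmx (L *m invmx (L - 1%:M)) *m (L *m u) = (L - 1%:M) *m u.
Proof.
move=> uL uL1.
have uD : L *m invmx (L - 1%:M) \in unitmx by rewrite unitmx_mul uL unitmx_inv.
have -> : L *m u = L *m invmx (L - 1%:M) *m ((L - 1%:M) *m u).
  by rewrite -mulmxA mulKmx.
exact: mulKmx.
Qed.

(** * The discrete l2 norm on complex vectors *)

Lemma sqr_l2norm (R : realType) n (v : 'cV[R[i]]_n) :
  ((l2norm v ^+ 2)%:C = ((map_mx conjc v)^T *m v) 0 0)%C.
Proof.
rewrite /l2norm sqr_sqrtr; last by apply: sumr_ge0 => i _; rewrite sqr_ge0.
rewrite rmorph_sum mxE; apply: eq_bigr => i _; rewrite !mxE.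
case: (v i 0) => c d; rewrite /Normc.normc sqr_sqrtr ?addr_ge0 ?sqr_ge0 //.
by apply/eqP; rewrite eq_complex /=; apply/andP; split; apply/eqP; ring.
Qed.

Lemma normc_ge0 (R : rcfType) (z : R[i]) : 0 <= Normc.normc z.
Proof. by case: z => c d; exact: sqrtr_ge0. Qed.

Lemma normc_real (R : rcfType) (c : R) : Normc.normc c%:C%C = `|c|.
Proof. by rewrite /= expr0n addr0 sqrtr_sqr. Qed.

Lemma l2norm_ge0 (R : realType) n (v : 'cV[R[i]]_n) : 0 <= l2norm v.
Proof. exact: sqrtr_ge0. Qed.

Lemma l2norm_orthogonal (R : realType) n (Q : 'M[R]_n) (v : 'cV[R[i]]_n) :
  Q^T *m Q = 1%:M -> l2norm (complexmx Q *m v) = l2norm v.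
Proof.
move=> QTQ; apply/eqP; rewrite -(eqrXn2 (n := 2)) ?l2norm_ge0 //; apply/eqP.
apply: (@complexI R); rewrite !sqr_l2norm map_mxM trmx_mul mulmxA.
rewrite -(mulmxA _ _ (complexmx Q)).
suff -> : (map_mx conjc (complexmx Q))^T *m complexmx Q = 1%:M by rewrite mulmx1.
have -> : map_mx conjc (complexmx Q) = complexmx Q.
  by apply/matrixP => i j; rewrite !mxE conjc_real.
by rewrite /complexmx matrix.map_trmx -map_mxM QTQ map_mx1.
Qed.

Lemma l2norm_le_scale (R : realType) n (c : R) (u v : 'cV[R[i]]_n) :
  0 <= c -> (forall i, Normc.normc (u i 0) <= c * Normc.normc (v i 0)) ->
  l2norm u <= c * l2norm v.
Proof.
move=> c0 uv; rewrite -(ger0_norm c0) -sqrtr_sqr -sqrtrM ?sqr_ge0 //.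
rewrite ler_wsqrtr // mulr_sumr; apply: ler_sum => i _.
by rewrite -exprMn lerXn2r ?nnegrE ?mulr_ge0 ?normc_ge0.
Qed.

(** * Chebyshev polynomials inside and outside the unit interval *)

Lemma chebyshevTSS (R : comNzRingType) n (s : R) :
  (chebyshevT R n.+2).[s] =
    2%:R * (s * (chebyshevT R n.+1).[s]) - (chebyshevT R n).[s].
Proof.
have -> : chebyshevT R n.+2 =
    2%:R *: ('X * chebyshevT R n.+1) - chebyshevT R n by [].
by rewrite !hornerE.
Qed.

(* Algebraic form of [cos ((n + 1) t) = cos t cos (n t) - sin t sin (n t)]:
   [u] plays the role of [sin (n t) / sin t]. *)
Lemma chebyshevT_sqr (R : comNzRingType) n (s : R) : exists u,
  (chebyshevT R n.+1).[s] = s * (chebyshevT R n).[s] - (1 - s ^+ 2) * u /\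
  (chebyshevT R n).[s] ^+ 2 + (1 - s ^+ 2) * u ^+ 2 = 1.
Proof.
elim: n => [|n [u [Tn1 Tn]]].
  by exists 0; rewrite /= hornerX hornerC; split; ring.
(* The sine addition formula for [sin ((n + 1) t)], divided by [sin t]. *)
exists (s * u + (chebyshevT R n).[s]); rewrite chebyshevTSS Tn1.
split; first by ring.
by apply: etrans Tn; ring.
Qed.

(** For these [s], [1 - s ^+ 2] is nonnegative, so the identity of [chebyshevT_sqr] writes 1 as the
    square of [T_n(s)] plus a nonnegative term. *)
Lemma chebyshevT_le1 (R : realDomainType) n (s : R) :
  `|s| <= 1 -> `|(chebyshevT R n).[s]| <= 1.
Proof.
move=> s1; have [u [_ Tn]] := chebyshevT_sqr n s.
rewrite -(ler_pXn2r (n := 2)) ?nnegrE // expr1n -normrX ger0_norm ?sqr_ge0 //.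
rewrite -Tn lerDl mulr_ge0 ?sqr_ge0 // subr_ge0 -[s ^+ 2]ger0_norm ?sqr_ge0 //.
by rewrite normrX exprn_ile1.
Qed.

Lemma chebyshevT_ge1 (R : realDomainType) n (s : R) :
  1 <= `|s| -> 1 <= `|(chebyshevT R n).[s]|.
Proof.
move=> s1.
(* The induction carries monotonicity in [n]: the recurrence gives [|T_(n+2)| >= 2 |s| |T_(n+1)| -
   |T_n| >= |T_(n+1)|]. *)
suff /andP[] : 1 <= `|(chebyshevT R n).[s]| <= `|(chebyshevT R n.+1).[s]| by [].
elim: n => [|n /andP[Tn TnS]]; first by rewrite /= !hornerE normr1 lexx.
rewrite (le_trans Tn TnS) chebyshevTSS /=.
apply: le_trans (lerB_dist _ _); rewrite !normrM (ger0_norm (ler0n R 2)).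
by nra.
Qed.

(* The reversal of [T_n] composed with the affine function [t |-> c * t + d]. *)
Lemma chebyshevT_homogenize (F : fieldType) n (c d : F) :
  exists2 p : {poly F}, (size p <= n.+1)%N &
    forall l, l != 0 -> p.[l] = l ^+ n * (chebyshevT F n).[c / l + d].
Proof.
have s1 : (size (d *: 'X + c%:P)%R <= 2)%N.
  rewrite (leq_trans (size_polyD _ _)) // geq_max size_polyC.
  by rewrite (leq_trans (size_scale_leq _ _)) ?size_polyX //=; case: eqP.
elim/ltn_ind: n => -[_|[_|n IH]].
- by exists 1 => [|l _]; rewrite ?size_poly1 //= !hornerE.
- by exists (d *: 'X + c%:P) => // l l0; rewrite /= !hornerE; field.
have [p sp Ep] := IH n (ltnW (ltnSn _)).
have [q sq Eq] := IH n.+1 (ltnSn _).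
(* The recurrence times [l ^+ n.+2]: one factor [l] turns [c / l + d] into [d * l + c], and the
   lower term is short of [l ^+ 2]. *)
exists (2%:R *: ((d *: 'X + c%:P) * q) - 'X^2 * p) => [|l l0].
  rewrite (leq_trans (size_polyD _ _)) // size_polyN geq_max; apply/andP; split.
    rewrite (leq_trans (size_scale_leq _ _)) // (leq_trans (size_polyMleq _ _)) //.
    by rewrite -subn1 leq_subLR; exact: leq_add s1 sq.
  by rewrite (leq_trans (size_polyMleq _ _)) // size_polyXn /= (leq_add2l 2 _ n.+1).
rewrite hornerD hornerN hornerZ !hornerM hornerD hornerZ !hornerX hornerC.
by rewrite Ep // Eq // chebyshevTSS !exprS; field.
Qed.

(** ['X^m - p] vanishes at 1, and dividing by ['X - 1] lowers the degree by one. The coefficients of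
    [q] will serve as a trial vector in the least-squares problem. *)
Lemma poly_sub_Xn_factor (F : fieldType) m (p : {poly F}) :
  (0 < m)%N -> (size p <= m.+1)%N -> p.[1] = 1 ->
  exists2 q : {poly F}, (size q <= m)%N & p = 'X^m - ('X - 1%:P) * q.
Proof.
move=> m0 sp p1.
have /factor_theorem[q Eq] : root ('X^m - p) 1.
  by rewrite rootE !hornerE p1 expr1n subrr.
exists q; last by rewrite mulrC -Eq opprB addrC subrK.
have [->|q0] := eqVneq q 0; first by rewrite size_poly0.
have := size_polyD 'X^m (- p); rewrite Eq size_polyN size_polyXn.
rewrite size_Mmonic ?monicXsubC // size_XsubC addn2 /= => h.
by rewrite -ltnS (leq_trans h) // geq_max leqnn.
Qed.

(** * The reciprocal of the spectral interval *)

Lemma notin_itvcc (R : realDomainType) (a b c : R) :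
  a < b -> c \notin `[a, b] -> b < c \/ c < a.
Proof.
move=> ab; rewrite in_itv /= negb_and -!ltNge => /orP[]; first by right.
by left.
Qed.

(** The function is affine in [1 / l] and takes the values 1 at [a] and -1 at [b]. Once denominators
    are cleared, the two bounds reduce to the signs of [a (b - l)] and [b (a - l)]. *)
Lemma reciprocal_interval_to_unit (R : realFieldType) (a b l : R) :
  a < b -> 0 \notin `[a, b] -> l \in `[a, b] ->
  `|2%:R * a * b / (b - a) / l + (- (a + b) / (b - a))| <= 1.
Proof.
move=> ab /(notin_itvcc ab) ab0; rewrite in_itv /= => /andP[al lb].
have l0 : l != 0 by apply/eqP; lra.
have ba0 : b - a != 0 by apply/eqP; lra.
have -> : 2%:R * a * b / (b - a) / l + (- (a + b) / (b - a)) =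
    (2%:R * a * b - (a + b) * l) / ((b - a) * l) by field; rewrite l0.
rewrite normf_div ler_pdivrMr ?normr_gt0 ?mulf_neq0 // mul1r normrM.
rewrite (@gtr0_norm _ (b - a)) ?subr_gt0 // ler_norml.
case: ab0 => h; [rewrite ltr0_norm ?(le_lt_trans lb) //|
  rewrite gtr0_norm ?(lt_le_trans h) //].
  by apply/andP; split; nra.
by apply/andP; split; nra.
Qed.

(** Subtracting or adding [b - a], the numerator becomes [2 b (a - 1)] or [2 a (b - 1)]; the
    positions of 0 and 1 fix the signs. *)
Lemma one_outside_unit (R : realFieldType) (a b : R) :
  a < b -> 0 \notin `[a, b] -> 1 \notin `[a, b] ->
  1 <= `|(2%:R * a * b - a - b) / (b - a)|.
Proof.
move=> ab /(notin_itvcc ab) ab0 /(notin_itvcc ab) ab1.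
have ba0 : 0 < b - a by lra.
rewrite normf_div (gtr0_norm ba0) ler_pdivlMr // mul1r ler_normr; apply/orP.
case: ab0 => [b0|a0]; first by left; nra.
by case: ab1 => [b1|a1]; [right|left]; nra.
Qed.

(** The polynomial [l ^+ m - (l - 1) * q.[l]] is the homogenized Chebyshev polynomial divided by its
    value [T1] at 1; homogenizing is what produces the weight [|l| ^+ m]. *)
Lemma chebyshev_Krylov_polynomial (R : realFieldType) m (a b : R) :
  (0 < m)%N -> a < b -> 0 \notin `[a, b] -> 1 \notin `[a, b] ->
  exists2 q : {poly R}, (size q <= m)%N &
    forall l, l \in `[a, b] -> `|l ^+ m - (l - 1) * q.[l]| <=
      `|(chebyshevT R m).[(2%:R * a * b - a - b) / (b - a)]|^-1 * `|l| ^+ m.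
Proof.
move=> m0 ab ab0 ab1.
have ba0 : b - a != 0 by rewrite subr_eq0 gt_eqF.
set T1 := (chebyshevT R m).[_].
have T1n : 1 <= `|T1| by apply/chebyshevT_ge1/one_outside_unit.
have T10 : T1 != 0 by rewrite -normr_gt0 (lt_le_trans ltr01).
have [p sp Ep] := chebyshevT_homogenize m
  (2%:R * a * b / (b - a)) (- (a + b) / (b - a)).
have p1 : p.[1] = T1.
  by rewrite Ep ?oner_eq0 // expr1n mul1r /T1; congr (_.[_]); field.
have [||q sq Eq] := @poly_sub_Xn_factor _ m (T1^-1 *: p) m0.
- by rewrite (leq_trans (size_scale_leq _ _)).
- by rewrite hornerZ p1 mulVf.
exists q => // l lab.
have l0 : l != 0 by apply: contraNneq ab0 => <-.
have -> : l ^+ m - (l - 1) * q.[l] = (T1^-1 *: p).[l] by rewrite Eq !hornerE.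
rewrite hornerZ Ep // !normrM normfV normrX ler_pM2l ?invr_gt0 ?normr_gt0 //.
rewrite ler_piMr ?exprn_ge0 //.
exact/chebyshevT_le1/reciprocal_interval_to_unit.
Qed.

(** * Diagonalization and residuals of the affine map *)

Lemma orthogonal_mul_diag (R : comNzRingType) n (A W : 'M[R]_n) (lam : 'rV[R]_n) :
  W^T *m W = 1%:M -> A = W *m diag_mx lam *m W^T ->
  W^T *m A = diag_mx lam *m W^T.
Proof. by move=> WTW ->; rewrite !mulmxA WTW mul1mx. Qed.

Lemma diag_eigenvalue (F : fieldType) n (A W : 'M[F]_n) (lam : 'rV[F]_n) i :
  W^T *m W = 1%:M -> A = W *m diag_mx lam *m W^T -> eigenvalue A (lam 0 i).
Proof.
(* [eigenvalue] refers to row vectors, hence a row of [W^T]; it is nonzero because the diagonal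
   entries of [W^T *m W] are 1. *)
move=> WTW EA; apply/eigenvalueP; exists (row i W^T).
  rewrite -row_mul (orthogonal_mul_diag WTW EA).
  by apply/rowP => j; rewrite mul_diag_mx !mxE.
apply/eqP => W0; have /rowP/(_ i) : row i (W^T *m W) = 0.
  by rewrite row_mul W0 mul0mx.
by rewrite WTW !mxE eqxx => /eqP; rewrite oner_eq0.
Qed.

Lemma diag_mx_unit (F : fieldType) n (d : 'rV[F]_n) :
  (forall i, d 0 i != 0) -> diag_mx d \in unitmx.
Proof. by move=> d0; rewrite unitmxE det_diag unitfE; apply/prodf_neq0 => i _. Qed.

Lemma complexmx_diag_mul (R : realType) n (d : 'rV[R]_n) (u : 'cV[R[i]]_n) j :
  (complexmx (diag_mx d) *m u) j 0 = (d 0 j)%:C%C * u j 0.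
Proof. by rewrite /complexmx map_diag_mx mul_diag_mx !mxE. Qed.

Lemma affine_residual (R : realType) n (M : 'M[R[i]]_n) (c xs : 'cV[R[i]]_n) x j :
  M *m xs + c = xs ->
  residual (fun v => M *m v + c) x j = (M - 1%:M) *m (x j - xs).
Proof.
move=> fix_xs; rewrite /residual mulmxBl mul1mx mulmxBr.
have -> : M *m xs = xs - c by rewrite -{2}fix_xs addrK.
by apply/colP => i; rewrite !mxE; ring.
Qed.

(** Each residual is [M - 1] applied to an error, and [xs] cancels in differences; hence [M - 1]
    factors out of the whole least-squares residual. *)
Lemma affine_residual_diffs (R : realType) n m k (M : 'M[R[i]]_n)
    (c xs : 'cV[R[i]]_n) x (v : 'cV[R[i]]_m) :
  let G := fun y => M *m y + c in
  G xs = xs ->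
  residual G x k - residual_diffs G x m k *m v =
    (M - 1%:M) *m (x k - xs -
      \sum_(j < m) v j 0 *: (x (k - m + j).+1 - x (k - m + j)%N)).
Proof.
move=> G fix_xs; rewrite mulmxBr -(affine_residual _ _ fix_xs); congr (_ - _).
apply/colP => i; rewrite mxE mulmx_sumr summxE; apply: eq_bigr => j _.
rewrite mxE !(affine_residual _ _ fix_xs) -mulmxBr opprB addrA subrK.
by rewrite -scalemxAr mulrC [in RHS]mxE.
Qed.

Theorem theorem3p1 (R : realType) (n m k : nat)
    (A W : 'M[R]_n) (lam : 'rV[R]_n) (bvec : 'cV[R[i]]_n) (a b : R)
    (xstar : 'cV[R[i]]_n) (x : nat -> 'cV[R[i]]_n) :
  let G := fun v : 'cV[R[i]]_n => complexmx A *m v + bvec in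
  let Lam : 'M[R[i]]_n := complexmx (diag_mx lam) in
  let Wstar : 'M[R[i]]_n := complexmx W^T in
  let e := fun j : nat => x j - xstar in
  let Dmu := Lam *m invmx (Lam - 1%:M) in
  let H := (Lam - 1%:M) ^+ 2 *m Lam ^+ (k - m) in
  let KH := krylov m Lam (H *m (Wstar *m e 0%N)) in
  let C := `| (chebyshevT R m).[(2%:R * a * b - a - b) / (b - a)] |^-1 in
  A^T = A ->
  W^T *m W = 1%:M ->
  A = W *m diag_mx lam *m W^T ->
  a < b ->
  (forall t : R, eigenvalue A t -> t \in `[a, b]) ->
  0 \notin `[a, b] ->
  1 \notin `[a, b] ->
  G xstar = xstar ->
  (1 <= m <= n)%N ->
  (m <= k)%N ->
  (forall j : nat, (j < k)%N -> x j.+1 = complexmx A *m x j + bvec) ->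
  anderson_step G x m k ->
  row_free KH^T ->
  l2norm (invmx Dmu *m (Wstar *m e k.+1)) <=
    C * l2norm (invmx Dmu *m (Wstar *m (complexmx A *m e k))).
Proof.
move=> G Lam Wstar e Dmu H KH C _ WTW EA ab Aab ab0 ab1 fix_xs /andP[m0 _] mk.
move=> xS [gamma gamma_min xk1] _.
have lam_ab i : lam 0 i \in `[a, b] by apply/Aab/(diag_eigenvalue i WTW EA).
have uLam : Lam \in unitmx.
  rewrite map_unitmx diag_mx_unit // => i.
  by apply: contraNneq ab0 => <-.
have Lam1E : Lam - 1%:M = complexmx (diag_mx (lam - const_mx 1)).
  by rewrite raddfB /= diag_const_mx /complexmx map_mxB map_mx1.
have uLam1 : Lam - 1%:M \in unitmx.
  rewrite Lam1E map_unitmx diag_mx_unit // => i; rewrite !mxE subr_eq0.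
  by apply: contraNneq ab1 => <-.
have WLam : Wstar *m complexmx A = Lam *m Wstar.
  by rewrite -!map_mxM (orthogonal_mul_diag WTW EA).
have WLam1 u : Wstar *m ((complexmx A - 1%:M) *m u) = (Lam - 1%:M) *m (Wstar *m u).
  by rewrite !mulmxBl !mul1mx mulmxBr !mulmxA WLam.
have WW : (W^T)^T *m W^T = 1%:M by rewrite trmxK; apply: mulmx1C.
(* The error after mixing with weights [v]: [A - 1] sends it to the least-squares residual for [v],
   and [A] sends [comb gamma] to [e k.+1]. *)
pose comb (v : 'cV[R[i]]_m) :=
  e k - \sum_(j < m) v j 0 *: (x (k - m + j).+1 - x (k - m + j)%N).
have ek1 : e k.+1 = complexmx A *m comb gamma.
  rewrite /e xk1 /comb mulmxBr mulmx_sumr -{1}fix_xs /G mulmxBr.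
  rewrite addrAC opprD addrACA subrr addr0; congr (_ - _).
  apply: eq_bigr => j _; rewrite -scalemxAr mulmxBr; congr (_ *: _).
  by rewrite opprD addrACA subrr addr0.
have comb_min v :
    l2norm ((Lam - 1%:M) *m (Wstar *m comb gamma)) <=
    l2norm ((Lam - 1%:M) *m (Wstar *m comb v)).
  have := gamma_min v; rewrite !(affine_residual_diffs _ _ _ fix_xs).
  by rewrite -!WLam1 !l2norm_orthogonal.
(* Up to index [k] the iteration is plain, so each eigencomponent of the error is multiplied by its
   eigenvalue at every step. *)
have We0 i j : (j <= k)%N ->
    (Wstar *m e j) i 0 = (lam 0 i ^+ j)%:C%C * (Wstar *m e 0) i 0.
  elim: j => [|j IH] jk; first by rewrite expr0 mul1r.
  have -> : e j.+1 = complexmx A *m e j.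
    by rewrite /e xS // -{1}fix_xs /G mulmxBr opprD addrACA subrr addr0.
  rewrite mulmxA WLam -mulmxA complexmx_diag_mul IH 1?ltnW //.
  by rewrite exprS rmorphM mulrA.
(* Both sides become norms of [Lam - 1] applied to a vector: [comb gamma] on the left and [e k] on
   the right, in the eigenbasis. *)
rewrite ek1 !(mulmxA Wstar) WLam -!(mulmxA Lam) !invmx_diag_quotient //.
have [q sq q_le] := chebyshev_Krylov_polynomial m0 ab ab0 ab1.
(* The minimizer is compared with the coefficients of [q], all of which fit since [size q <= m]. *)
pose v := \col_(j < m) (q`_j)%:C%C : 'cV[R[i]]_m.
apply: le_trans (comb_min v) _.
apply: l2norm_le_scale => [|i]; first by rewrite invr_ge0.
rewrite Lam1E !complexmx_diag_mul.
set l := lam 0 i.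
(* The difference of index [k - m + j] contributes [(l - 1) * l ^+ (k - m + j)]; summed against the
   coefficients, these assemble [q.[l]]. *)
have comb_i : (Wstar *m comb v) i 0 =
    (l ^+ (k - m) * (l ^+ m - (l - 1) * q.[l]))%:C%C * (Wstar *m e 0) i 0.
  have -> : (Wstar *m comb v) i 0 = (Wstar *m e k) i 0 -
      \sum_(j < m) (q`_j)%:C%C *
        ((Wstar *m e (k - m + j).+1) i 0 - (Wstar *m e (k - m + j)%N) i 0).
    rewrite /comb mulmxBr mulmx_sumr mxE [X in _ + X]mxE summxE; congr (_ - _).
    apply: eq_bigr => j _; rewrite -scalemxAr mxE [v j 0]mxE; congr (_ * _).
    by rewrite /e mulmxBr !mulmxBr !mxE opprB addrA subrK.
  rewrite We0 // (horner_coef_wide _ sq) mulrBr -exprD subnK // mulrA.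
  rewrite rmorphB mulrBl mulr_sumr rmorph_sum mulr_suml; congr (_ - _).
  apply: eq_bigr => j _; have jk : (k - m + j < k)%N.
    by rewrite -[X in (_ < X)%N](subnK mk) ltn_add2l.
  rewrite (We0 _ _ jk) (We0 _ _ (ltnW jk)) -mulrBl -rmorphB mulrA -rmorphM -/l.
  by congr (_%:C%C * _); rewrite exprS exprD; ring.
(* Cancelling [|l - 1|], [|l| ^+ (k - m)] and the modulus of the initial component leaves [q_le]. *)
rewrite comb_i (We0 i k) // !Normc.normcM !normc_real.
rewrite [leRHS]mulrCA ler_wpM2l // [leRHS]mulrA ler_wpM2r ?normc_ge0 //.
rewrite -{2}(subnK mk) exprD !normrM [leRHS]mulrCA ler_wpM2l //.
by rewrite [`|l ^+ m|]normrX; exact/q_le/lam_ab.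
Qed.
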